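(* Let $\mathsf{M}$ be a theory with provability predicate $\Box$ and consistency sentence $\mathrm{Con}(\mathsf{M})$ as described in the context, and let $Y^J(k)$ be a formula of the language of $\mathsf{M}$ with the single free variable $k$ such that $$\mathsf{M}\vdash Y^J(k) \leftrightarrow (\forall x > k)\,[\Box(\ulcorner \neg Y^J(\dot{x})\urcorner)].$$ Then, with $k$ a free variable, $$\mathsf{M}\vdash \mathrm{Con}(\mathsf{M})\leftrightarrow \neg Y^J(k).$$
   Context: $\mathsf{M}$ is a recursively enumerable first-order theory (classical logic) of reasonable power in the language of arithmetic, for instance Peano arithmetic $\mathsf{PA}$; ''reasonable power'' may be read as: $\mathsf{M}$ extends elementary arithmetic $I\Delta_0+\mathrm{exp}$. Notation. $\bar{n}$ is the numeral of the natural number $n$. $\ulcorner\phi\urcorner$ is the numeral of the Gödel number of $\phi$. With $x$ a variable, $\ulcorner\phi(\dot{x})\urcorner$ denotes the ($\mathsf{M}$-definable) function of $x$ whose value at $n$ is the Gödel number of the sentence $\phi(\bar{n})$ (similarly for several variables), so that $x$ is free in $\Box(\ulcorner\phi(\dot{x})\urcorner)$. $x\,\underline{\rightarrow}\,y$ denotes the arithmetized function taking Gödel numbers of two formulas to the Gödel number of the implication between them. $\Box$ is a standard provability predicate for $\mathsf{M}$: a $\Sigma_1$ formula with one free variable, true in the standard model of exactly the Gödel numbers of theorems of $\mathsf{M}$, and satisfying the generalized derivability conditions: (GD1) if $\mathsf{M}\vdash\phi(x)$ then $\mathsf{M}\vdash\Box(\ulcorner\phi(\dot{x})\urcorner)$;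 (GD2) $\mathsf{M}\vdash\Box(x\,\underline{\rightarrow}\,y)\rightarrow(\Box(x)\rightarrow\Box(y))$; (GD3) for every $\Sigma_1$ formula $\psi(y_1,\ldots,y_n)$, $\mathsf{M}\vdash\psi(y_1,\ldots,y_n)\rightarrow\Box(\ulcorner\psi(\dot{y}_1,\ldots,\dot{y}_n)\urcorner)$. $\mathrm{Con}(\mathsf{M})$ is the arithmetical consistency sentence $\neg\Box(\ulcorner 0=1\urcorner)$. A formula $Y^J$ as in the claim exists by the diagonal lemma with free variables. *)

(* Defs.v *)
(* Standard library only. *)
From Stdlib Require Import Arith Lia List.
Import ListNotations.
Set Implicit Arguments.

(** * First-order arithmetic, with de Bruijn indices *)

Inductive term : Type :=
| Var (i : nat)
| Zero
| Succ (t : term)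
| Add (t u : term)
| Mul (t u : term).

Inductive form : Type :=
| Bot
| Eq (t u : term)
| Lt (t u : term)
| Imp (p q : form)
| And (p q : form)
| Or (p q : form)
| All (p : form)
| Ex (p : form).

Definition Neg (p : form) : form := Imp p Bot.
Definition Iff (p q : form) : form := And (Imp p q) (Imp q p).

Fixpoint num (n : nat) : term :=
  match n with 0 => Zero | S n => Succ (num n) end.

(** ** Parallel substitution *)

Definition scons {A : Type} (a : A) (s : nat -> A) (i : nat) : A :=
  match i with 0 => a | S i => s i end.

Fixpoint subst_term (s : nat -> term) (t : term) : term :=
  match t with
  | Var i => s i
  | Zero => Zero
  | Succ t => Succ (subst_term s t)
  | Add t u => Add (subst_term s t) (subst_term s u)
  | Mul t u => Mul (subst_term s t) (subst_term s u)
  end.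

Definition shift_term : term -> term := subst_term (fun i => Var (S i)).

Definition up (s : nat -> term) : nat -> term :=
  scons (Var 0) (fun i => shift_term (s i)).

Fixpoint subst (s : nat -> term) (p : form) : form :=
  match p with
  | Bot => Bot
  | Eq t u => Eq (subst_term s t) (subst_term s u)
  | Lt t u => Lt (subst_term s t) (subst_term s u)
  | Imp p q => Imp (subst s p) (subst s q)
  | And p q => And (subst s p) (subst s q)
  | Or p q => Or (subst s p) (subst s q)
  | All p => All (subst (up s) p)
  | Ex p => Ex (subst (up s) p)
  end.

Definition shift : form -> form := subst (fun i => Var (S i)).

(* Replaces variable 0 by [t] and lowers the other variables. *)
Definition inst (t : term) : form -> form := subst (scons t Var).

(** ** Free variables *)

Fixpoint term_fv_below (n : nat) (t : term) : Prop :=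
  match t with
  | Var i => i < n
  | Zero => True
  | Succ t => term_fv_below n t
  | Add t u | Mul t u => term_fv_below n t /\ term_fv_below n u
  end.

Fixpoint fv_below (n : nat) (p : form) : Prop :=
  match p with
  | Bot => True
  | Eq t u | Lt t u => term_fv_below n t /\ term_fv_below n u
  | Imp p q | And p q | Or p q => fv_below n p /\ fv_below n q
  | All p | Ex p => fv_below (S n) p
  end.

Definition sentence : form -> Prop := fv_below 0.

(** ** The standard model *)

Fixpoint eval (r : nat -> nat) (t : term) : nat :=
  match t with
  | Var i => r i
  | Zero => 0
  | Succ t => S (eval r t)
  | Add t u => eval r t + eval r u
  | Mul t u => eval r t * eval r u
  end.

Fixpoint sat (r : nat -> nat) (p : form) : Prop :=
  match p with
  | Bot => False
  | Eq t u => eval r t = eval r u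
  | Lt t u => eval r t < eval r u
  | Imp p q => sat r p -> sat r q
  | And p q => sat r p /\ sat r q
  | Or p q => sat r p \/ sat r q
  | All p => forall n, sat (scons n r) p
  | Ex p => exists n, sat (scons n r) p
  end.

(** ** Classical natural deduction with equality *)

Inductive deriv : list form -> form -> Prop :=
| D_ax G p : In p G -> deriv G p
| D_raa G p : deriv (Neg p :: G) Bot -> deriv G p
| D_impI G p q : deriv (p :: G) q -> deriv G (Imp p q)
| D_impE G p q : deriv G (Imp p q) -> deriv G p -> deriv G q
| D_andI G p q : deriv G p -> deriv G q -> deriv G (And p q)
| D_andE1 G p q : deriv G (And p q) -> deriv G p
| D_andE2 G p q : deriv G (And p q) -> deriv G q
| D_orI1 G p q : deriv G p -> deriv G (Or p q)
| D_orI2 G p q : deriv G q -> deriv G (Or p q)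
| D_orE G p q r :
    deriv G (Or p q) -> deriv (p :: G) r -> deriv (q :: G) r -> deriv G r
| D_allI G p : deriv (map shift G) p -> deriv G (All p)
| D_allE G p t : deriv G (All p) -> deriv G (inst t p)
| D_exI G p t : deriv G (inst t p) -> deriv G (Ex p)
| D_exE G p q :
    deriv G (Ex p) -> deriv (p :: map shift G) (shift q) -> deriv G q
| D_refl G t : deriv G (Eq t t)
| D_leibniz G p t u :
    deriv G (Eq t u) -> deriv G (inst t p) -> deriv G (inst u p).

(* A theory is given by its axioms. A provable formula may have free
   variables, which amounts to provability of its universal closure when the
   axioms are sentences. *)
Definition theory : Type := form -> Prop.

Definition provable (M : theory) (p : form) : Prop :=
  exists G : list form, (forall q, In q G -> M q) /\ deriv G p.

(** ** Delta_0 and Sigma_1 formulas *)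

(* Since bounds are shifted, they do not contain the quantified variable. *)
Inductive Delta0 : form -> Prop :=
| Delta0_bot : Delta0 Bot
| Delta0_eq t u : Delta0 (Eq t u)
| Delta0_lt t u : Delta0 (Lt t u)
| Delta0_imp p q : Delta0 p -> Delta0 q -> Delta0 (Imp p q)
| Delta0_and p q : Delta0 p -> Delta0 q -> Delta0 (And p q)
| Delta0_or p q : Delta0 p -> Delta0 q -> Delta0 (Or p q)
| Delta0_all t p :
    Delta0 p -> Delta0 (All (Imp (Lt (Var 0) (shift_term t)) p))
| Delta0_ex t p :
    Delta0 p -> Delta0 (Ex (And (Lt (Var 0) (shift_term t)) p)).

Inductive Sigma1 : form -> Prop :=
| Sigma1_Delta0 p : Delta0 p -> Sigma1 p
| Sigma1_ex p : Sigma1 p -> Sigma1 (Ex p).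

(** ** Elementary arithmetic *)

(* Goedel's beta function: [u] is the remainder of [a] modulo
   [1 + (i + 1) * b]. *)
Definition beta (a b i u : term) : form :=
  let m := Succ (Mul (Succ i) b) in
  And (Lt u m)
      (Ex (Eq (shift_term a)
              (Add (Mul (Var 0) (shift_term m)) (shift_term u)))).

(* [y = 2 ^ x] for x = [Var 1], y = [Var 0]: some pair (a, b) beta-codes a
   sequence starting with 1, doubling at each of its first x steps, whose
   entry of index x is y. Over IDelta_0, totality of this graph is equivalent
   to totality of the usual Delta_0 graph of exponentiation. Inside the two
   quantifiers, a = [Var 1], b = [Var 0], y = [Var 2], x = [Var 3]. *)
Definition exp_graph : form :=
  Ex (Ex (And (beta (Var 1) (Var 0) Zero (num 1))
    (And (All (Imp (Lt (Var 0) (Var 4))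
            (Ex (And (beta (Var 3) (Var 2) (Var 1) (Var 0))
                     (beta (Var 3) (Var 2) (Succ (Var 1))
                           (Add (Var 0) (Var 0)))))))
         (beta (Var 1) (Var 0) (Var 3) (Var 2))))).

(* Axioms are open formulas, standing for their universal closures; in
   particular the free variables of the induction formula other than
   [Var 0] are parameters. *)
Inductive IDelta0_exp : theory :=
| EA_succ_zero : IDelta0_exp (Neg (Eq (Succ (Var 0)) Zero))
| EA_succ_inj :
    IDelta0_exp (Imp (Eq (Succ (Var 0)) (Succ (Var 1))) (Eq (Var 0) (Var 1)))
| EA_add_zero : IDelta0_exp (Eq (Add (Var 0) Zero) (Var 0))
| EA_add_succ :
    IDelta0_exp (Eq (Add (Var 0) (Succ (Var 1))) (Succ (Add (Var 0) (Var 1))))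
| EA_mul_zero : IDelta0_exp (Eq (Mul (Var 0) Zero) Zero)
| EA_mul_succ :
    IDelta0_exp
      (Eq (Mul (Var 0) (Succ (Var 1))) (Add (Mul (Var 0) (Var 1)) (Var 0)))
| EA_lt :
    IDelta0_exp (Iff (Lt (Var 0) (Var 1))
                     (Ex (Eq (Add (Var 1) (Succ (Var 0))) (Var 2))))
| EA_ind p :
    Delta0 p ->
    IDelta0_exp
      (Imp (inst Zero p)
        (Imp (All (Imp p (subst (scons (Succ (Var 0)) (fun i => Var (S i))) p)))
          (All p)))
| EA_exp : IDelta0_exp (Ex exp_graph).

Definition extends (M T : theory) : Prop := forall p, T p -> provable M p.

(** * Goedel numbering *)

(* An injective polynomial; being a polynomial, it is also a term operation. *)
Definition pair (a b : nat) : nat := (a + b) * (a + b) + a.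
Definition pairT (t u : term) : term := Add (Mul (Add t u) (Add t u)) t.

(* The code of S^k t, where t does not start with a successor, records k and
   the code of t. With this run-length encoding of successors the code of the
   numeral of n is a polynomial in n. *)
Fixpoint gterm (k : nat) (t : term) : nat :=
  match t with
  | Succ t => gterm (S k) t
  | Zero => pair k (pair 0 0)
  | Var i => pair k (pair 1 i)
  | Add t u => pair k (pair 2 (pair (gterm 0 t) (gterm 0 u)))
  | Mul t u => pair k (pair 3 (pair (gterm 0 t) (gterm 0 u)))
  end.

Fixpoint gnum (p : form) : nat :=
  match p with
  | Bot => pair 0 0
  | Eq t u => pair 1 (pair (gterm 0 t) (gterm 0 u))
  | Lt t u => pair 2 (pair (gterm 0 t) (gterm 0 u))
  | Imp p q => pair 3 (pair (gnum p) (gnum q))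
  | And p q => pair 4 (pair (gnum p) (gnum q))
  | Or p q => pair 5 (pair (gnum p) (gnum q))
  | All p => pair 6 (gnum p)
  | Ex p => pair 7 (gnum p)
  end.

Definition quote (p : form) : term := num (gnum p).

(* The arithmetized implication. *)
Definition impT (t u : term) : term := pairT (num 3) (pairT t u).

(* [dot p] is the code of [p] in which all free variables are dotted: as a
   function of its variables x_0, x_1, ... it is the code of the formula
   obtained from [p] by replacing each free variable i by the numeral of x_i
   (see [dot_correct]). In [dot_term d] and [dot_form d], the variables below
   [d] are bound in the formula being coded. *)
Fixpoint dot_term (d k : nat) (t : term) : term :=
  match t with
  | Succ t => dot_term d (S k) t
  | Zero => pairT (num k) (num (pair 0 0))
  | Var i =>
      if i <? d then pairT (num k) (num (pair 1 i))
      else pairT (Add (num k) (Var (i - d))) (num (pair 0 0))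
  | Add t u =>
      pairT (num k) (pairT (num 2) (pairT (dot_term d 0 t) (dot_term d 0 u)))
  | Mul t u =>
      pairT (num k) (pairT (num 3) (pairT (dot_term d 0 t) (dot_term d 0 u)))
  end.

Fixpoint dot_form (d : nat) (p : form) : term :=
  match p with
  | Bot => num (pair 0 0)
  | Eq t u => pairT (num 1) (pairT (dot_term d 0 t) (dot_term d 0 u))
  | Lt t u => pairT (num 2) (pairT (dot_term d 0 t) (dot_term d 0 u))
  | Imp p q => impT (dot_form d p) (dot_form d q)
  | And p q => pairT (num 4) (pairT (dot_form d p) (dot_form d q))
  | Or p q => pairT (num 5) (pairT (dot_form d p) (dot_form d q))
  | All p => pairT (num 6) (dot_form (S d) p)
  | Ex p => pairT (num 7) (dot_form (S d) p)
  end.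

Definition dot (p : form) : term := dot_form 0 p.

(** ** The numbering is injective, and dotting computes substitution *)

Lemma pair_inj a b c d : pair a b = pair c d -> a = c /\ b = d.
Proof. unfold pair; intros H; assert (a + b = c + d) by nia; nia. Qed.

Fixpoint succs (k : nat) (t : term) : term :=
  match k with 0 => t | S k => Succ (succs k t) end.

Lemma succs_Succ k t : succs k (Succ t) = Succ (succs k t).
Proof. induction k; simpl; congruence. Qed.

Lemma gterm_inj t u k l : gterm k t = gterm l u -> succs k t = succs l u.
Proof.
  revert u k l; induction t as [i| |t IH|t1 IH1 t2 IH2|t1 IH1 t2 IH2].
  3: intros u k l H; rewrite succs_Succ; exact (IH u (S k) l H).
  all: induction u as [j| |u IHu|u1 _ u2 _|u1 _ u2 _]; intros k l H.
  all: try (rewrite succs_Succ; exact (IHu k (S l) H)).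
  all: simpl in H; apply pair_inj in H; destruct H as [<- H];
    apply pair_inj in H; destruct H as [E H]; try discriminate E.
  1: now rewrite H.
  1: reflexivity.
  all: apply pair_inj in H; destruct H as [H1 H2];
    apply IH1 in H1; apply IH2 in H2; simpl in H1, H2; now subst.
Qed.

Lemma gnum_inj p q : gnum p = gnum q -> p = q.
Proof.
  revert q; induction p; intros [] H; simpl in H; apply pair_inj in H;
    destruct H as [E H]; try discriminate E; try reflexivity;
    try (apply pair_inj in H; destruct H as [H1 H2]).
  all: try (apply gterm_inj in H1; apply gterm_inj in H2; simpl in H1, H2;
            now subst).
  all: f_equal; auto.
Qed.

Lemma eval_num r n : eval r (num n) = n.
Proof. induction n; simpl; congruence. Qed.

Lemma eval_pairT r t u : eval r (pairT t u) = pair (eval r t) (eval r u).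
Proof. reflexivity. Qed.

Definition numeral_subst (d : nat) (r : nat -> nat) (i : nat) : term :=
  if i <? d then Var i else num (r (i - d)).

Lemma gterm_num k n : gterm k (num n) = pair (k + n) (pair 0 0).
Proof.
  revert k; induction n; intros k; simpl.
  - now rewrite Nat.add_0_r.
  - rewrite IHn. f_equal; lia.
Qed.

Lemma dot_term_correct r d k t :
  eval r (dot_term d k t) = gterm k (subst_term (numeral_subst d r) t).
Proof.
  revert k; induction t as [i| |t IH|t1 IH1 t2 IH2|t1 IH1 t2 IH2]; intros k.
  - cbn [dot_term subst_term]; unfold numeral_subst;
      destruct (i <? d); rewrite eval_pairT.
    + rewrite !eval_num; reflexivity.
    + rewrite gterm_num; cbn [eval]; now rewrite !eval_num.
  - cbn [dot_term]; rewrite eval_pairT, !eval_num; reflexivity.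
  - exact (IH (S k)).
  - cbn [dot_term]; rewrite !eval_pairT, !eval_num, IH1, IH2; reflexivity.
  - cbn [dot_term]; rewrite !eval_pairT, !eval_num, IH1, IH2; reflexivity.
Qed.

Lemma subst_term_ext s s' t :
  (forall i, s i = s' i) -> subst_term s t = subst_term s' t.
Proof. intros H; induction t; simpl; congruence. Qed.

Lemma up_ext s s' : (forall i, s i = s' i) -> forall i, up s i = up s' i.
Proof. intros H [|i]; unfold up; simpl; now rewrite ?H. Qed.

Lemma subst_ext p : forall s s',
  (forall i, s i = s' i) -> subst s p = subst s' p.
Proof.
  induction p; intros s s' H; simpl; f_equal;
    eauto using subst_term_ext, up_ext.
Qed.

Lemma shift_num n : shift_term (num n) = num n.
Proof. unfold shift_term; induction n; simpl; congruence. Qed.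

Lemma up_numeral_subst d r i :
  up (numeral_subst d r) i = numeral_subst (S d) r i.
Proof.
  destruct i as [|i]; [reflexivity|].
  unfold up, numeral_subst; simpl.
  change (S i <? S d) with (i <? d).
  destruct (i <? d); [reflexivity|apply shift_num].
Qed.

Lemma dot_form_correct r p : forall d,
  eval r (dot_form d p) = gnum (subst (numeral_subst d r) p).
Proof.
  induction p; intros d; cbn [dot_form subst gnum]; unfold impT;
    rewrite ?eval_pairT, ?eval_num, ?dot_term_correct, ?IHp1, ?IHp2, ?IHp;
    try reflexivity.
  all: do 2 f_equal; apply subst_ext; intros i; symmetry;
    apply up_numeral_subst.
Qed.

Theorem dot_correct r p :
  eval r (dot p) = gnum (subst (fun i => num (r i)) p).
Proof.
  unfold dot; rewrite dot_form_correct; f_equal; apply subst_ext; intros i.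
  unfold numeral_subst; now rewrite Nat.sub_0_r.
Qed.

Theorem impT_correct r t u p q :
  eval r t = gnum p -> eval r u = gnum q ->
  eval r (impT t u) = gnum (Imp p q).
Proof.
  intros Ht Hu; unfold impT; now rewrite !eval_pairT, eval_num, Ht, Hu.
Qed.

(** * Recursively enumerable sets *)

(* Partial recursive functions of a list of arguments. *)
Inductive recfn : Type :=
| RZero
| RSucc
| RProj (i : nat)
| RComp (f : recfn) (gs : list recfn)
| RPrim (f g : recfn)
| RMin (f : recfn).

Inductive reval : recfn -> list nat -> nat -> Prop :=
| reval_zero xs : reval RZero xs 0
| reval_succ x xs : reval RSucc (x :: xs) (S x)
| reval_proj i xs x : nth_error xs i = Some x -> reval (RProj i) xs x
| reval_comp f gs xs ys z :
    revals gs xs ys -> reval f ys z -> reval (RComp f gs) xs z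
| reval_prim0 f g xs z : reval f xs z -> reval (RPrim f g) (0 :: xs) z
| reval_primS f g n xs y z :
    reval (RPrim f g) (n :: xs) y -> reval g (n :: y :: xs) z ->
    reval (RPrim f g) (S n :: xs) z
| reval_min f xs n :
    reval f (n :: xs) 0 ->
    (forall m, m < n -> exists k, reval f (m :: xs) (S k)) ->
    reval (RMin f) xs n
with revals : list recfn -> list nat -> list nat -> Prop :=
| revals_nil xs : revals [] xs []
| revals_cons g gs xs y ys :
    reval g xs y -> revals gs xs ys -> revals (g :: gs) xs (y :: ys).

Definition rec_enumerable (A : nat -> Prop) : Prop :=
  exists f : recfn, forall n, A n <-> exists m, reval f [n] m.

Definition re_theory (M : theory) : Prop :=
  rec_enumerable (fun n => exists p, M p /\ gnum p = n).

(** * Provability predicates *)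

(* [app B t] is [B(t)], for a formula [B] in the single variable [Var 0]. *)
Definition app (B : form) (t : term) : form := inst t B.

(* Here the formula has at most the one free variable [Var 0], which is
   dotted. *)
Definition GD1 (M : theory) (B : form) : Prop :=
  forall p, fv_below 1 p -> provable M p -> provable M (app B (dot p)).

Definition GD2 (M : theory) (B : form) : Prop :=
  provable M (Imp (app B (impT (Var 0) (Var 1)))
                  (Imp (app B (Var 0)) (app B (Var 1)))).

Definition GD3 (M : theory) (B : form) : Prop :=
  forall p, Sigma1 p -> provable M (Imp p (app B (dot p))).

Definition provability_predicate (M : theory) (B : form) : Prop :=
  Sigma1 B /\ fv_below 1 B /\
  (forall r n,
     sat r (app B (num n)) <-> exists p, provable M p /\ gnum p = n) /\
  GD1 M B /\ GD2 M B /\ GD3 M B.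

Definition Con (B : form) : form := Neg (app B (quote (Eq Zero (num 1)))).

(* Main.v *)
From Stdlib Require Import Arith Lia List.
Import ListNotations.
Require Import Defs.

(** Write [e] for [0 = 1] and [□ p] for [app Box (dot p)].

    The sentence [□ e] implies [Y(k)]: the theory proves [e -> ~ Y(x)], so
    [□ e] gives [□ ~ Y(x)] for every [x], which is the right-hand side of the
    fixed-point equation ([box_false_to_Y]). Contraposed, [~ Y(k)] implies
    consistency, and this is itself a theorem with one free variable.

    Conversely, instantiating the fixed-point equation at [x = k + 1] shows
    that [Y(k)] implies [□ ~ Y(k + 1)]. As [~ Y(x)] provably implies
    consistency, the theory then believes that it proves its own consistency,
    and the formalized second incompleteness theorem yields [□ e]
    ([box_consistency_to_box_false]). A single one of the infinitely many
    clauses of [Y(k)] thus carries its whole strength.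

    The second incompleteness theorem rests on a sentence [G] equivalent to
    [~ □ G]. Its usual construction arithmetizes substitution, which would mean
    defining a computable function in the theory and proving its properties
    there. The numbering offers a shortcut. The diagonalization of [p] is taken
    to be [exists x, x = n /\ p(x)] with [n] the code of [p], and since the
    code of the numeral of [n] is a polynomial in [n], so is the code of the
    diagonalization ([diag_code]). The diagonal function is then a term of the
    language, and the only arithmetic behind the [diagonal_lemma] is that closed
    terms provably have their values ([closed_term_value]). *)

(** * Substitution *)

Lemma subst_term_comp s s' t :
  subst_term s (subst_term s' t) = subst_term (fun i => subst_term s (s' i)) t.
Proof. induction t; simpl; congruence. Qed.

Lemma subst_term_Var t : subst_term Var t = t.
Proof. induction t; simpl; congruence. Qed.

Lemma subst_term_shift s t :
  subst_term s (shift_term t) = subst_term (fun i => s (S i)) t.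
Proof. apply subst_term_comp. Qed.

Lemma subst_term_scons_shift a s t :
  subst_term (scons a s) (shift_term t) = subst_term s t.
Proof. apply subst_term_shift. Qed.

Lemma subst_term_up_shift s t :
  subst_term (up s) (shift_term t) = shift_term (subst_term s t).
Proof.
  rewrite subst_term_shift. unfold shift_term. now rewrite subst_term_comp.
Qed.

Lemma up_comp s s' i :
  subst_term (up s) (up s' i) = up (fun i => subst_term s (s' i)) i.
Proof. destruct i; [reflexivity|]. apply subst_term_up_shift. Qed.

Lemma subst_comp p : forall s s',
  subst s (subst s' p) = subst (fun i => subst_term s (s' i)) p.
Proof.
  induction p; intros s s'; simpl; f_equal; auto using subst_term_comp.
  all: rewrite IHp; apply subst_ext, up_comp.
Qed.

Lemma subst_Var p : subst Var p = p.
Proof.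
  induction p; simpl; f_equal; auto using subst_term_Var.
  all: rewrite <- IHp at 2; apply subst_ext; now intros [|i].
Qed.

Lemma subst_inst s t p :
  subst s (inst t p) = inst (subst_term s t) (subst (up s) p).
Proof.
  unfold inst. rewrite !subst_comp. apply subst_ext. intros [|i]; simpl.
  - reflexivity.
  - unfold up; simpl. rewrite subst_term_scons_shift.
    symmetry. apply subst_term_Var.
Qed.

Lemma subst_up_shift s p : subst (up s) (shift p) = shift (subst s p).
Proof. unfold shift. rewrite !subst_comp. now apply subst_ext. Qed.

Lemma subst_term_agree n s s' t :
  term_fv_below n t -> (forall i, i < n -> s i = s' i) ->
  subst_term s t = subst_term s' t.
Proof. intros Ht H; induction t; simpl in *; f_equal; intuition. Qed.

Lemma subst_agree p : forall n s s',
  fv_below n p -> (forall i, i < n -> s i = s' i) -> subst s p = subst s' p.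
Proof.
  induction p; intros n s s' Hp H; simpl in *; f_equal;
    try (destruct Hp; eauto using subst_term_agree; fail).
  all: apply (IHp (S n)); [exact Hp|].
  all: intros [|i] Hi; [reflexivity|]; unfold up; simpl.
  all: f_equal; apply H; lia.
Qed.

Lemma subst_term_closed s t : term_fv_below 0 t -> subst_term s t = t.
Proof.
  intros Ht. rewrite <- (subst_term_Var t) at 2.
  apply (subst_term_agree 0); [exact Ht|lia].
Qed.

Lemma subst_sentence s p : sentence p -> subst s p = p.
Proof.
  intros Hp. rewrite <- (subst_Var p) at 2.
  apply (subst_agree p 0); [exact Hp|lia].
Qed.

Lemma term_fv_below_subst n m s t :
  term_fv_below n t -> (forall i, i < n -> term_fv_below m (s i)) ->
  term_fv_below m (subst_term s t).
Proof. intros Ht H; induction t; simpl in *; intuition. Qed.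

Lemma fv_below_subst p : forall n m s,
  fv_below n p -> (forall i, i < n -> term_fv_below m (s i)) ->
  fv_below m (subst s p).
Proof.
  induction p; intros n m s Hp H; simpl in *;
    try (destruct Hp; split; eauto using term_fv_below_subst; fail); auto.
  all: apply (IHp (S n)); [exact Hp|].
  all: intros [|i] Hi; unfold up; simpl; [lia|].
  all: apply (term_fv_below_subst m); [apply H; lia|simpl; lia].
Qed.

Lemma fv_below_weaken n m p : n <= m -> fv_below n p -> fv_below m p.
Proof.
  intros H Hp. rewrite <- (subst_Var p).
  apply (fv_below_subst p n); [exact Hp|simpl; lia].
Qed.

Lemma subst_app s B t :
  fv_below 1 B -> subst s (app B t) = app B (subst_term s t).
Proof.
  intros HB. unfold app, inst. rewrite subst_comp.
  apply (subst_agree B 1); [exact HB|]. intros [|i] Hi; [reflexivity|lia].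
Qed.

Lemma fv_below_app n B t :
  fv_below 1 B -> term_fv_below n t -> fv_below n (app B t).
Proof.
  intros HB Ht. apply (fv_below_subst B 1); [exact HB|].
  intros [|i] Hi; [exact Ht|lia].
Qed.

Lemma Delta0_subst p : Delta0 p -> forall s, Delta0 (subst s p).
Proof.
  induction 1; intros s; cbn [subst subst_term];
    rewrite ?subst_term_up_shift; constructor; auto.
Qed.

Lemma Sigma1_subst p : Sigma1 p -> forall s, Sigma1 (subst s p).
Proof.
  induction 1; intros s.
  - now apply Sigma1_Delta0, Delta0_subst.
  - apply Sigma1_ex, IHSigma1.
Qed.

(** * Codes of formulas with dotted variables *)

Lemma term_fv_below_num m n : term_fv_below m (num n).
Proof. induction n; simpl; auto. Qed.

Lemma term_fv_below_pairT m t u :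
  term_fv_below m t -> term_fv_below m u -> term_fv_below m (pairT t u).
Proof. simpl; tauto. Qed.

Lemma term_fv_below_dot_term n d t : forall k,
  term_fv_below (d + n) t -> term_fv_below n (dot_term d k t).
Proof.
  induction t; intros k Ht; cbn [dot_term];
    try match type of Ht with
        | term_fv_below _ (Var _) => fail 1
        | _ => cbn [term_fv_below] in Ht; destruct Ht
        end;
    try (destruct (Nat.ltb_spec i d));
    repeat apply term_fv_below_pairT; auto using term_fv_below_num.
  (* a variable that is free in the coded formula *)
  simpl in *; lia.
Qed.

Lemma term_fv_below_dot_form n p : forall d,
  fv_below (d + n) p -> term_fv_below n (dot_form d p).
Proof.
  induction p; intros d Hp; cbn [dot_form]; unfold impT;
    try (cbn [fv_below] in Hp; destruct Hp);
    repeat apply term_fv_below_pairT;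
    auto using term_fv_below_num, term_fv_below_dot_term.
Qed.

Lemma term_fv_below_dot n p : fv_below n p -> term_fv_below n (dot p).
Proof. exact (term_fv_below_dot_form n p 0). Qed.

Lemma eval_dot_sentence r p : sentence p -> eval r (dot p) = gnum p.
Proof. intros Hp. now rewrite dot_correct, subst_sentence. Qed.

(** * Derivations *)

Lemma deriv_weaken G p : deriv G p -> forall G', incl G G' -> deriv G' p.
Proof.
  (* contexts grow by a head, or are shifted as a whole *)
  assert (Hc : forall (a : form) (l m : list form),
             incl l m -> incl (a :: l) (a :: m))
    by (intros a l m H x [->|Hx]; [now left|right; auto]).
  induction 1; intros G' HG.
  - apply D_ax; auto.
  - apply D_raa; auto.
  - apply D_impI; auto.
  - eapply D_impE; eauto.
  - apply D_andI; auto.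
  - eapply D_andE1; eauto.
  - eapply D_andE2; eauto.
  - apply D_orI1; auto.
  - apply D_orI2; auto.
  - eapply D_orE; eauto.
  - apply D_allI; auto using incl_map.
  - apply D_allE; auto.
  - eapply D_exI; eauto.
  - eapply D_exE; eauto using incl_map.
  - apply D_refl.
  - eapply D_leibniz; eauto.
Qed.

Lemma deriv_subst G p :
  deriv G p -> forall s, deriv (map (subst s) G) (subst s p).
Proof.
  assert (Hsh : forall s G,
    map (subst (up s)) (map shift G) = map shift (map (subst s) G))
    by (intros s G0; rewrite !map_map; apply map_ext; intros a;
        apply subst_up_shift).
  induction 1; intros s; cbn [subst subst_term map] in *.
  - now apply D_ax, in_map.
  - apply D_raa, IHderiv.
  - apply D_impI, IHderiv.
  - eapply D_impE; eauto.
  - apply D_andI; auto.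
  - eapply D_andE1; eauto.
  - eapply D_andE2; eauto.
  - apply D_orI1; auto.
  - apply D_orI2; auto.
  - eapply D_orE; eauto.
  - apply D_allI. rewrite <- Hsh. apply IHderiv.
  - rewrite subst_inst. apply D_allE, IHderiv.
  - apply (D_exI _ (subst_term s t)). rewrite <- subst_inst. apply IHderiv.
  - eapply D_exE; [apply IHderiv1|].
    rewrite <- Hsh, <- subst_up_shift. apply IHderiv2.
  - apply D_refl.
  - rewrite subst_inst. eapply D_leibniz; [apply IHderiv1|].
    rewrite <- subst_inst. apply IHderiv2.
Qed.

Lemma provable_mp M p q :
  provable M (Imp p q) -> provable M p -> provable M q.
Proof.
  intros (G1 & H1 & D1) (G2 & H2 & D2). exists (G1 ++ G2); split.
  - intros r Hr. apply in_app_or in Hr. destruct Hr; auto.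
  - eapply D_impE; eapply deriv_weaken; eauto using incl_appl, incl_appr,
      incl_refl.
Qed.

(** This reduces a step inside the theory to a derivation whose hypotheses are
    the theorems it combines. *)
Lemma provable_cut M G p :
  (forall q, In q G -> provable M q) -> deriv G p -> provable M p.
Proof.
  revert p; induction G as [|q G IH]; intros p HG D.
  - exists []; split; [intros q []|exact D].
  - apply (provable_mp M q); [|apply HG; now left].
    apply IH; [intros r Hr; apply HG; now right|now apply D_impI].
Qed.

Ltac cut_with L :=
  apply (provable_cut _ L);
  [let q := fresh "q" in let H := fresh "H" in
   intros q H; simpl in H;
   repeat (destruct H as [<-|H]; [assumption|]); destruct H|].

Ltac hyp := apply D_ax; simpl; tauto.

Lemma provable_imp_trans M p q r :
  provable M (Imp p q) -> provable M (Imp q r) -> provable M (Imp p r).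
Proof.
  intros H1 H2. cut_with [Imp p q; Imp q r].
  apply D_impI, D_impE with q; [hyp|]. apply D_impE with p; hyp.
Qed.

Lemma provable_iff_l M p q : provable M (Iff p q) -> provable M (Imp p q).
Proof. intros H. cut_with [Iff p q]. eapply D_andE1; hyp. Qed.

Lemma provable_iff_r M p q : provable M (Iff p q) -> provable M (Imp q p).
Proof. intros H. cut_with [Iff p q]. eapply D_andE2; hyp. Qed.

(** The hypothesis that axioms are sentences enters here and in
    [provable_imp_all]: the axioms used are then unchanged by substitutions. *)
Lemma provable_subst M s p :
  (forall q, M q -> sentence q) -> provable M p -> provable M (subst s p).
Proof.
  intros HM (G & HG & D). exists G; split; [exact HG|].
  apply (deriv_subst G p) with (s := s) in D.
  rewrite (map_ext_in _ (fun q => q)), map_id in D; [exact D|].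
  intros q Hq. now apply subst_sentence, HM, HG.
Qed.

Lemma provable_imp_all M p q :
  (forall q, M q -> sentence q) -> sentence p ->
  provable M (Imp p q) -> provable M (Imp p (All q)).
Proof.
  intros HM Hp (G & HG & D). exists G; split; [exact HG|].
  apply D_impI, D_allI.
  replace (map shift (p :: G)) with (p :: G).
  - apply D_impE with p; [|hyp].
    eapply deriv_weaken; [exact D|]. apply incl_tl, incl_refl.
  - symmetry. rewrite <- (map_id (p :: G)) at 2. apply map_ext_in.
    intros r [<-|Hr]; apply subst_sentence; auto.
Qed.

(** * Equality and values of closed terms *)

Lemma provable_eq_subst M p t u :
  provable M (Eq t u) -> provable M (inst t p) -> provable M (inst u p).
Proof.
  intros H1 H2. cut_with [Eq t u; inst t p].
  apply D_leibniz with t; hyp.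
Qed.

Lemma provable_eq_app M B t u :
  provable M (Eq t u) -> provable M (Imp (app B t) (app B u)).
Proof.
  intros H. cut_with [Eq t u].
  apply D_impI, D_leibniz with t; hyp.
Qed.

Lemma provable_eq_refl M t : provable M (Eq t t).
Proof. apply (provable_cut _ []); [intros q []|apply D_refl]. Qed.

Lemma inst_shift_eq t u v :
  inst v (Eq t (shift_term u)) = Eq (subst_term (scons v Var) t) u.
Proof.
  unfold inst. cbn [subst]. now rewrite subst_term_scons_shift, subst_term_Var.
Qed.

Lemma provable_eq_sym M t u : provable M (Eq t u) -> provable M (Eq u t).
Proof.
  intros H. change (Eq u t) with (Eq (subst_term (scons u Var) (Var 0)) t).
  rewrite <- inst_shift_eq.
  apply provable_eq_subst with t; [exact H|].
  rewrite inst_shift_eq. apply provable_eq_refl.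
Qed.

Lemma provable_eq_trans M t u v :
  provable M (Eq t u) -> provable M (Eq u v) -> provable M (Eq t v).
Proof.
  intros H1 H2. apply provable_eq_sym.
  change (Eq v t) with (Eq (subst_term (scons v Var) (Var 0)) t).
  rewrite <- inst_shift_eq.
  apply provable_eq_subst with u; [exact H2|].
  rewrite inst_shift_eq. now apply provable_eq_sym.
Qed.

Lemma provable_eq_cong M c t u :
  provable M (Eq t u) ->
  provable M (Eq (subst_term (scons t Var) c) (subst_term (scons u Var) c)).
Proof.
  intros H. rewrite <- inst_shift_eq.
  apply provable_eq_subst with u; [now apply provable_eq_sym|].
  rewrite inst_shift_eq. apply provable_eq_refl.
Qed.

Lemma provable_eq_succ M t u :
  provable M (Eq t u) -> provable M (Eq (Succ t) (Succ u)).
Proof. exact (provable_eq_cong M (Succ (Var 0)) t u). Qed.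

(** A binary operation changes one argument at a time, with the other one
    weakened past the place of the hole. *)
Lemma provable_eq_binary M (f : term -> term -> term) t u t' u' :
  (forall s a b,
     subst_term s (f a b) = f (subst_term s a) (subst_term s b)) ->
  provable M (Eq t t') -> provable M (Eq u u') ->
  provable M (Eq (f t u) (f t' u')).
Proof.
  intros Hf Ht Hu. apply provable_eq_trans with (f t' u).
  - pose proof (provable_eq_cong M (f (Var 0) (shift_term u)) t t' Ht) as H.
    now rewrite !Hf, !subst_term_scons_shift, !subst_term_Var in H.
  - pose proof (provable_eq_cong M (f (shift_term t') (Var 0)) u u' Hu) as H.
    now rewrite !Hf, !subst_term_scons_shift, !subst_term_Var in H.
Qed.

Section Arithmetic.

Variable M : theory.
Hypothesis HM : forall q, M q -> sentence q.
Hypothesis Hext : extends M IDelta0_exp.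

Lemma axiom_instance t u p :
  IDelta0_exp p -> provable M (subst (scons t (scons u Var)) p).
Proof. intros Hp. apply provable_subst; auto. Qed.

Lemma add_num a b : provable M (Eq (Add (num a) (num b)) (num (a + b))).
Proof.
  induction b as [|b IH].
  - rewrite Nat.add_0_r. exact (axiom_instance (num a) Zero _ EA_add_zero).
  - rewrite Nat.add_succ_r. eapply provable_eq_trans.
    + exact (axiom_instance (num a) (num b) _ EA_add_succ).
    + now apply provable_eq_succ.
Qed.

Lemma mul_num a b : provable M (Eq (Mul (num a) (num b)) (num (a * b))).
Proof.
  induction b as [|b IH].
  - rewrite Nat.mul_0_r. exact (axiom_instance (num a) Zero _ EA_mul_zero).
  - rewrite Nat.mul_succ_r. eapply provable_eq_trans.
    + exact (axiom_instance (num a) (num b) _ EA_mul_succ).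
    + eapply provable_eq_trans; [|apply add_num].
      apply provable_eq_binary; auto using provable_eq_refl.
Qed.

Lemma closed_term_value r t :
  term_fv_below 0 t -> provable M (Eq t (num (eval r t))).
Proof.
  induction t; cbn [term_fv_below eval]; intros Ht.
  - lia.
  - apply provable_eq_refl.
  - apply provable_eq_succ; auto.
  - eapply provable_eq_trans; [|apply add_num].
    destruct Ht. apply provable_eq_binary; auto.
  - eapply provable_eq_trans; [|apply mul_num].
    destruct Ht. apply provable_eq_binary; auto.
Qed.

Lemma dot_eq_quote p : sentence p -> provable M (Eq (dot p) (quote p)).
Proof.
  intros Hp. unfold quote. rewrite <- (eval_dot_sentence (fun _ => 0) p Hp).
  now apply closed_term_value, term_fv_below_dot.
Qed.

Lemma zero_neq_one : provable M (Neg (Eq Zero (num 1))).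
Proof.
  pose proof (axiom_instance Zero Zero _ EA_succ_zero) as H.
  cbn in H. cut_with [Neg (Eq (Succ Zero) Zero)].
  apply D_impI, D_impE with (Eq (Succ Zero) Zero); [hyp|].
  (* symmetry of equality, under the hypothesis Zero = Succ Zero *)
  apply (D_leibniz (t := Zero) (u := Succ Zero) (Eq (Var 0) Zero));
    [hyp|apply D_refl].
Qed.

Lemma lt_succ : provable M (Lt (Var 0) (Succ (Var 0))).
Proof.
  pose proof (axiom_instance (Var 0) (Succ (Var 0)) _ EA_lt) as H.
  apply provable_iff_r in H. apply (provable_mp _ _ _ H).
  cbn. assert (E : provable M (Eq (Add (Var 0) (Succ Zero)) (Succ (Var 0)))).
  { eapply provable_eq_trans.
    - exact (axiom_instance (Var 0) Zero _ EA_add_succ).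
    - apply provable_eq_succ.
      exact (axiom_instance (Var 0) Zero _ EA_add_zero). }
  cut_with [Eq (Add (Var 0) (Succ Zero)) (Succ (Var 0))].
  apply D_exI with Zero. hyp.
Qed.

(** * The diagonal lemma *)

(** When [t] denotes the code [n] of [p], this denotes the code of
    [exists x, x = n /\ p(x)]. It is a term because the code of the numeral of
    [n] is [pair n (pair 0 0)]. *)
Definition diag_code (t : term) : term :=
  pairT (num 7) (pairT (num 4)
    (pairT (pairT (num 1)
              (pairT (num (gterm 0 (Var 0))) (pairT t (num (pair 0 0)))))
       t)).

Lemma subst_diag_code s t :
  subst_term s (diag_code t) = diag_code (subst_term s t).
Proof. reflexivity. Qed.

Definition diag (p : form) : form := Ex (And (Eq (Var 0) (quote p)) p).

Lemma eval_diag_code r p : eval r (diag_code (quote p)) = gnum (diag p).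
Proof.
  unfold diag_code, diag, quote. cbn [gnum].
  now rewrite !eval_pairT, !eval_num, gterm_num.
Qed.

Lemma sentence_diag p : fv_below 1 p -> sentence (diag p).
Proof.
  intros Hp. unfold sentence, diag, quote.
  simpl; auto using term_fv_below_num.
Qed.

Lemma diag_iff p :
  fv_below 1 p -> provable M (Iff (diag p) (app p (quote p))).
Proof.
  intros Hp.
  assert (Hq : sentence (app p (quote p)))
    by (apply fv_below_app; [exact Hp|apply term_fv_below_num]).
  apply (provable_cut _ []); [intros q []|]. apply D_andI; apply D_impI.
  - eapply D_exE; [hyp|].
    unfold shift at 2. rewrite subst_sentence by exact Hq.
    apply (D_leibniz (t := Var 0) p); [eapply D_andE1; hyp|].
    replace (inst (Var 0) p) with p; [eapply D_andE2; hyp|].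
    rewrite <- (subst_Var p) at 1. apply (subst_agree p 1); [exact Hp|].
    intros [|i] Hi; [reflexivity|lia].
  - apply D_exI with (quote p). apply D_andI; [|hyp].
    cbn [subst subst_term scons].
    rewrite subst_term_closed by apply term_fv_below_num. apply D_refl.
Qed.

Theorem diagonal_lemma B :
  fv_below 1 B ->
  exists G, sentence G /\ provable M (Iff G (app B (quote G))).
Proof.
  intros HB. set (p := app B (diag_code (Var 0))).
  assert (Hp : fv_below 1 p).
  { apply fv_below_app; [exact HB|]. unfold diag_code.
    repeat apply term_fv_below_pairT; auto using term_fv_below_num.
    all: simpl; lia. }
  exists (diag p). split; [now apply sentence_diag|].
  assert (Hd : term_fv_below 0 (diag_code (quote p))).
  { unfold diag_code, quote.
    repeat apply term_fv_below_pairT; auto using term_fv_below_num. }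
  assert (E : provable M (Eq (diag_code (quote p)) (quote (diag p)))).
  { unfold quote at 2. rewrite <- (eval_diag_code (fun _ => 0)).
    now apply closed_term_value. }
  assert (Ha : app p (quote p) = app B (diag_code (quote p))).
  { unfold p at 1. unfold app at 1, inst at 1.
    rewrite subst_app by exact HB. now rewrite subst_diag_code. }
  pose proof (diag_iff p Hp) as H0. rewrite Ha in H0.
  pose proof (provable_eq_app M B _ _ E) as H1.
  pose proof (provable_eq_app M B _ _ (provable_eq_sym _ _ _ E)) as H2.
  pose proof (provable_imp_trans _ _ _ _ (provable_iff_l _ _ _ H0) H1) as H3.
  pose proof (provable_imp_trans _ _ _ _ H2 (provable_iff_r _ _ _ H0)) as H4.
  cut_with [Imp (diag p) (app B (quote (diag p)));
            Imp (app B (quote (diag p))) (diag p)].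
  apply D_andI; hyp.
Qed.

(** * The second incompleteness theorem inside the theory *)

Variable Box : form.
Hypothesis HS : Sigma1 Box.
Hypothesis Hfv : fv_below 1 Box.
Hypothesis HGD1 : GD1 M Box.
Hypothesis HGD2 : GD2 M Box.
Hypothesis HGD3 : GD3 M Box.

Definition box (p : form) : form := app Box (dot p).

Definition false_eq : form := Eq Zero (num 1).

Lemma sentence_false_eq : sentence false_eq.
Proof. unfold sentence; simpl; auto. Qed.

Lemma fv_below_box n p : fv_below n p -> fv_below n (box p).
Proof.
  intros Hp. apply fv_below_app; [exact Hfv|]. now apply term_fv_below_dot.
Qed.

Lemma box_K p q : provable M (Imp (box (Imp p q)) (Imp (box p) (box q))).
Proof.
  pose proof (provable_subst M (scons (dot p) (scons (dot q) Var)) _ HM HGD2)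
    as H.
  cbn [subst] in H. rewrite !subst_app in H by exact Hfv. exact H.
Qed.

Lemma box_mono p q :
  fv_below 1 p -> fv_below 1 q ->
  provable M (Imp p q) -> provable M (Imp (box p) (box q)).
Proof.
  intros Hp Hq H. apply (provable_mp _ _ _ (box_K p q)).
  apply HGD1; [simpl; auto|exact H].
Qed.

Lemma box_4 p : provable M (Imp (box p) (box (box p))).
Proof. apply HGD3. now apply Sigma1_subst. Qed.

Lemma box_quote p :
  sentence p ->
  provable M (Imp (box p) (app Box (quote p))) /\
  provable M (Imp (app Box (quote p)) (box p)).
Proof.
  intros Hp; split; apply provable_eq_app.
  - now apply dot_eq_quote.
  - now apply provable_eq_sym, dot_eq_quote.
Qed.

Lemma goedel_sentence :
  exists G, sentence G /\
    provable M (Imp G (Neg (box G))) /\ provable M (Imp (Neg (box G)) G).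
Proof.
  destruct (diagonal_lemma (Neg Box)) as (G & HG & H); [simpl; auto|].
  exists G. split; [exact HG|].
  destruct (box_quote G HG) as [H1 H2].
  change (app (Neg Box) (quote G)) with (Neg (app Box (quote G))) in H.
  pose proof (provable_iff_l _ _ _ H) as H3.
  pose proof (provable_iff_r _ _ _ H) as H4.
  split.
  - cut_with [Imp G (Neg (app Box (quote G)));
              Imp (box G) (app Box (quote G))].
    apply D_impI, D_impI.
    apply D_impE with (app Box (quote G)).
    + apply D_impE with G; hyp.
    + apply D_impE with (box G); hyp.
  - cut_with [Imp (Neg (app Box (quote G))) G;
              Imp (app Box (quote G)) (box G)].
    apply D_impI. apply D_impE with (Neg (app Box (quote G))); [hyp|].
    apply D_impI. apply D_impE with (box G); [hyp|].
    apply D_impE with (app Box (quote G)); hyp.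
Qed.

(** The refutation of [G] from [box G] is itself carried out under [box]: from
    [box G] follow both [box (box G)] and [box (box G -> 0 = 1)]. *)
Lemma box_goedel_to_box_false G :
  sentence G -> provable M (Imp G (Neg (box G))) ->
  provable M (Imp (box G) (box false_eq)).
Proof.
  intros HG H.
  assert (HG1 : fv_below 1 G) by (apply fv_below_weaken with 0; auto).
  assert (H1 : provable M (Imp G (Imp (box G) false_eq))).
  { cut_with [Imp G (Neg (box G))].
    apply D_impI, D_impI, D_raa.
    apply D_impE with (box G); [|hyp]. apply D_impE with G; hyp. }
  apply box_mono in H1; [|exact HG1|].
  2:{ split; [now apply fv_below_box|simpl; auto]. }
  pose proof (box_K (box G) false_eq) as H2.
  pose proof (box_4 G) as H3.
  cut_with [Imp (box G) (box (Imp (box G) false_eq));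
            Imp (box (Imp (box G) false_eq))
                (Imp (box (box G)) (box false_eq));
            Imp (box G) (box (box G))].
  apply D_impI. apply D_impE with (box (box G)).
  - apply D_impE with (box (Imp (box G) false_eq)); [hyp|].
    apply D_impE with (box G); hyp.
  - apply D_impE with (box G); hyp.
Qed.

(** The formalized second incompleteness theorem, for any formula [p] that
    implies consistency. The term [t] is substituted only at the end, outside
    the box: [inst t (box p)] speaks of [p] at the numeral of the value of [t],
    whereas [box (inst t p)] has the term [t] itself inside the coded formula.
*)
Lemma box_consistency_to_box_false p t :
  fv_below 1 p -> provable M (Imp p (Neg (box false_eq))) ->
  provable M (Imp (inst t (box p)) (box false_eq)).
Proof.
  intros Hp H. destruct goedel_sentence as (G & HG & H1 & H2).
  assert (HG1 : fv_below 1 G) by (apply fv_below_weaken with 0; auto).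
  pose proof (box_goedel_to_box_false G HG H1) as H3.
  assert (H4 : provable M (Imp p G)).
  { cut_with [Imp p (Neg (box false_eq)); Imp (Neg (box G)) G;
              Imp (box G) (box false_eq)].
    apply D_impI. apply D_impE with (Neg (box G)); [hyp|].
    apply D_impI. apply D_impE with (box false_eq).
    - apply D_impE with p; hyp.
    - apply D_impE with (box G); hyp. }
  apply box_mono in H4; [|exact Hp|exact HG1].
  pose proof (provable_imp_trans _ _ _ _ H4 H3) as H5.
  apply (provable_subst M (scons t Var)) in H5; [|exact HM].
  cbn [subst] in H5.
  rewrite (subst_sentence _ (box false_eq)) in H5; [exact H5|].
  apply fv_below_box, sentence_false_eq.
Qed.

Lemma box_false_to_Y Y :
  fv_below 1 Y ->
  provable M (Iff Y (All (Imp (Lt (Var 1) (Var 0)) (box (Neg Y))))) ->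
  provable M (Imp (box false_eq) Y).
Proof.
  intros HY HF.
  assert (H1 : provable M (Imp false_eq (Neg Y))).
  { pose proof zero_neq_one as H. fold false_eq in H.
    cut_with [Neg false_eq]. apply D_impI, D_impI.
    apply D_impE with false_eq; hyp. }
  apply box_mono in H1; [|simpl; auto|simpl; auto].
  eapply provable_imp_trans; [|apply (provable_iff_r _ _ _ HF)].
  apply provable_imp_all; [exact HM|apply fv_below_box, sentence_false_eq|].
  cut_with [Imp (box false_eq) (box (Neg Y))].
  apply D_impI, D_impI. apply D_impE with (box false_eq); hyp.
Qed.

End Arithmetic.

(* k is the variable [Var 0]; under the quantifier over x it becomes [Var 1],
   and x, which is dotted, is [Var 0]. *)
Theorem theorem7 (M : theory) (Box Y : form)
  (M_sentences : forall p, M p -> sentence p)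
  (M_re : re_theory M)
  (M_ext : extends M IDelta0_exp)
  (Box_prov : provability_predicate M Box)
  (Y_fv : fv_below 1 Y)
  (Y_fix : provable M
     (Iff Y (All (Imp (Lt (Var 1) (Var 0)) (app Box (dot (Neg Y))))))) :
  provable M (Iff (Con Box) (Neg Y)).
Proof.
  destruct Box_prov as (HS & Hfv & _ & H1 & H2 & H3).
  assert (HA : provable M (Imp (box Box false_eq) Y))
    by (eapply box_false_to_Y; eauto).
  assert (HB : provable M
    (Imp (inst (Succ (Var 0)) (box Box (Neg Y))) (box Box false_eq))).
  { eapply box_consistency_to_box_false; eauto; [simpl; auto|].
    cut_with [Imp (box Box false_eq) Y]. apply D_impI, D_impI.
    apply D_impE with Y; [hyp|].
    apply D_impE with (box Box false_eq); hyp. }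
  (* the clause x = k + 1 of Y(k) *)
  assert (HC : provable M (Imp Y (inst (Succ (Var 0)) (box Box (Neg Y))))).
  { pose proof (lt_succ M M_sentences M_ext) as Hlt.
    apply provable_iff_l in Y_fix.
    cut_with [Lt (Var 0) (Succ (Var 0));
              Imp Y (All (Imp (Lt (Var 1) (Var 0)) (box Box (Neg Y))))].
    apply D_impI. apply D_impE with (Lt (Var 0) (Succ (Var 0))); [|hyp].
    apply (D_allE (p := Imp (Lt (Var 1) (Var 0)) (box Box (Neg Y)))
             (Succ (Var 0))).
    apply D_impE with Y; hyp. }
  destruct (box_quote M M_sentences M_ext Box false_eq sentence_false_eq)
    as [HQ HQ'].
  pose proof (provable_imp_trans _ _ _ _ HC
                (provable_imp_trans _ _ _ _ HB HQ)) as HD.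
  pose proof (provable_imp_trans _ _ _ _ HQ' HA) as HE.
  unfold Con. fold false_eq.
  cut_with [Imp Y (app Box (quote false_eq));
            Imp (app Box (quote false_eq)) Y].
  apply D_andI; apply D_impI, D_impI.
  - apply D_impE with (app Box (quote false_eq)); [hyp|].
    apply D_impE with Y; hyp.
  - apply D_impE with Y; [hyp|].
    apply D_impE with (app Box (quote false_eq)); hyp.
Qed.
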